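(* Let $(Z^{\bullet,j},d^{\bullet,j})$, $S^{i,j}$, $P^{i,j}$ be as described in the context, and assume that every $S^{i,j}$ has closed range. Let $(Y^\bullet,d_V^\bullet)$ be the twisted complex with the operators $P_V^i=F^{i-1}P^i(F^i)^{-1}$, let $(\Upsilon^\bullet,\mathscr{D}^\bullet)$ be the BGG complex, and let $A^i:\Upsilon^i\to Y^i$, $B^i:Y^i\to\Upsilon^i$ be the maps defined in the context. Define $\mathscr{P}^i:=B^{i-1}P_V^iA^i:\Upsilon^i\to\Upsilon^{i-1}$. Then $$\mathscr{D}^{i-1}\mathscr{P}^i+\mathscr{P}^{i+1}\mathscr{D}^i=I\ \text{ for } i>0,\qquad\text{and}\qquad \mathscr{D}^0\mathscr{P}^1\mathscr{D}^0=\mathscr{D}^0 .$$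
   Context: For $0\le i\le n$, $0\le j\le N$ let $Z^{i,j}$ be Hilbert spaces; spaces with indices out of range, and operators from or to them, are zero. Let $d^{i,j}:Z^{i,j}\to Z^{i+1,j}$ be bounded linear operators with $d^{i+1,j}d^{i,j}=0$, and let $S^{i,j}:Z^{i,j}\to Z^{i+1,j-1}$ be bounded linear operators with $d^{i+1,j-1}S^{i,j}=-S^{i+1,j}d^{i,j}$ and $S^{i+1,j-1}S^{i,j}=0$ for all $i,j$. Let $P^{i,j}:Z^{i,j}\to Z^{i-1,j}$, $i=1,\dots,n$, be bounded linear operators with $d^{i-1,j}P^{i,j}+P^{i+1,j}d^{i,j}=I_{Z^{i,j}}$ for $i>0$ and $d^{0,j}P^{1,j}d^{0,j}=d^{0,j}$. Put $Y^i=Z^{i,0}\times\cdots\times Z^{i,N}$ (Hilbert space product); $d^i:Y^i\to Y^{i+1}$ and $P^i:Y^i\to Y^{i-1}$ act componentwise through $d^{i,j}$, $P^{i,j}$, and $S^i:Y^i\to Y^{i+1}$ is $S^i(u_0,\dots,u_N)=(S^{i,1}u_1,\dots,S^{i,N}u_N,0)$. The twisted complex is $(Y^\bullet,d_V^\bullet)$ with $d_V^i=d^i-S^i$. The operator $P^{i+1}S^i$ on $Y^i$ is nilpotent; $F^i:=(I-P^{i+1}S^i)^{-1}=\sum_{l\ge0}(P^{i+1}S^i)^l$. BGG complex (closed ranges of the $S^{i,j}$ assumed). Let $\Upsilon^i:=\ker(S^i)\cap\operatorname{ran}(S^{i-1})^\perp\subset Y^i$ and let $\Pi_{\Upsilon^i}:Y^i\to\Upsilon^i$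 be the orthogonal projection. Let $T^i:Y^i\to Y^{i-1}$ be $T^i:=(S^{i-1}|_{\ker(S^{i-1})^\perp})^{-1}\circ\Pi_{\operatorname{ran}(S^{i-1})}$, where $\Pi_{\operatorname{ran}(S^{i-1})}$ is the orthogonal projection onto $\operatorname{ran}(S^{i-1})$; it has components $Z^{i,j}\to Z^{i-1,j+1}$. Put $G^i:=-\sum_{k\ge0}(T^id^{i-1})^kT^i:Y^i\to Y^{i-1}$ (a finite sum), $A^i:=(I-G^{i+1}d_V^i)|_{\Upsilon^i}:\Upsilon^i\to Y^i$, $B^i:=\Pi_{\Upsilon^i}(I-d_V^{i-1}G^i):Y^i\to\Upsilon^i$, and $\mathscr{D}^i:=\Pi_{\Upsilon^{i+1}}d_V^iA^i:\Upsilon^i\to\Upsilon^{i+1}$. The BGG complex is $(\Upsilon^\bullet,\mathscr{D}^\bullet)$. *)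

(* Defs.v *)
From HB Require Import structures.
From mathcomp Require Import all_boot all_order all_algebra.
From mathcomp Require Export sesquilinear complex.
From mathcomp Require Import all_classical all_reals all_analysis.

Set Implicit Arguments.
Unset Strict Implicit.
Unset Printing Implicit Defensive.

Import Order.TTheory GRing.Theory Num.Theory.
Local Open Scope classical_set_scope.
Local Open Scope ring_scope.

(** ** Hilbert spaces over the real or the complex numbers *)

Inductive real_or_complex : forall K : numFieldType, {rmorphism K -> K} -> Prop :=
| real_scalars (R : realType) : @real_or_complex R idfun
| complex_scalars (R : realType) : @real_or_complex R[i] Num.conj.

Record hilbertType (K : numFieldType) (theta : {rmorphism K -> K}) := Hilbert {
  hilbert_space :> completeNormedModType K;
  hdot : {dot hilbert_space for theta};
  hdotE : forall x, `|x| ^+ 2 = hdot x x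
}.

Definition bounded_operator (K : numFieldType) (V W : normedModType K)
    (f : V -> W) := exists M : K, forall x, `|f x| <= M * `|x|.

Section orthogonal_projection.
Variables (K : numFieldType) (V : lmodType K) (dot : V -> V -> K).

Definition orth (W : set V) : set V := [set x | forall w, W w -> dot x w = 0].

(* The value is determined when [dot] is an inner product and [W] is a linear
   subspace such that [x] has a nearest point in [W]. *)
Definition oproj (W : set V) (x : V) : V :=
  xget 0 [set y | W y /\ orth W (x - y)].

End orthogonal_projection.

(** ** Finite products of Hilbert spaces *)

Definition hprod (K : numFieldType) (I : finType) (E : I -> lmodType K) :=
  forall i, E i.

Section hprod_lmodType.
Variables (K : numFieldType) (I : finType) (E : I -> lmodType K).
Implicit Types u v w : hprod E.

HB.instance Definition _ := gen_eqMixin (hprod E).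
HB.instance Definition _ := gen_choiceMixin (hprod E).

Let hprod_add u v : hprod E := fun i => u i + v i.
Let hprod_opp u : hprod E := fun i => - u i.
Let hprod_zero : hprod E := fun=> 0.
Let hprod_scale (a : K) u : hprod E := fun i => a *: u i.

Let hprod_addA : associative hprod_add.
Proof. by move=> u v w; apply: functional_extensionality_dep => i; exact: addrA. Qed.
Let hprod_addC : commutative hprod_add.
Proof. by move=> u v; apply: functional_extensionality_dep => i; exact: addrC. Qed.
Let hprod_add0 : left_id hprod_zero hprod_add.
Proof. by move=> u; apply: functional_extensionality_dep => i; exact: add0r. Qed.
Let hprod_addN : left_inverse hprod_zero hprod_opp hprod_add.
Proof. by move=> u; apply: functional_extensionality_dep => i; exact: addNr. Qed.

HB.instance Definition _ := GRing.isZmodule.Build (hprod E)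
  hprod_addA hprod_addC hprod_add0 hprod_addN.

Let hprod_scaleA a b u :
  hprod_scale a (hprod_scale b u) = hprod_scale (a * b) u.
Proof. by apply: functional_extensionality_dep => i; exact: scalerA. Qed.
Let hprod_scale1 : left_id 1 hprod_scale.
Proof. by move=> u; apply: functional_extensionality_dep => i; exact: scale1r. Qed.
Let hprod_scaleDr : right_distributive hprod_scale +%R.
Proof. by move=> a u v; apply: functional_extensionality_dep => i; exact: scalerDr. Qed.
Let hprod_scaleDl u : {morph hprod_scale^~ u : a b / a + b}.
Proof. by move=> a b; apply: functional_extensionality_dep => i; exact: scalerDl. Qed.

HB.instance Definition _ := GRing.Zmodule_isLmodule.Build K (hprod E)
  hprod_scaleA hprod_scale1 hprod_scaleDr hprod_scaleDl.

Lemma hprodD u v i : (u + v) i = u i + v i. Proof. by []. Qed.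
Lemma hprodN u i : (- u) i = - u i. Proof. by []. Qed.
Lemma hprodZ a u i : (a *: u) i = a *: u i. Proof. by []. Qed.
Lemma hprod0 i : (0 : hprod E) i = 0. Proof. by []. Qed.
Lemma hprodP u v : (forall i, u i = v i) -> u = v.
Proof. by move=> uv; apply: functional_extensionality_dep. Qed.

End hprod_lmodType.

Section hprod_dot.
Variables (K : numFieldType) (theta : {rmorphism K -> K}) (I : finType).
Variable E : I -> hilbertType theta.

Definition pdot (u v : hprod E) : K := \sum_i hdot (E i) (u i) (v i).

Let pdot_bilinear : bilinear_for
  (GRing.Scale.Law.clone _ _ ( *%R ) _) (GRing.Scale.Law.clone _ _ (theta \; *%R ) _) pdot.
Proof.
split=> [v a u w|u a v w] /=; rewrite /pdot.
  rewrite mulr_sumr -big_split; apply: eq_bigr => i _ /=.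
  by rewrite hprodD hprodZ linearDl linearZl_LR.
rewrite mulr_sumr -big_split; apply: eq_bigr => i _ /=.
by rewrite hprodD hprodZ linearDr linearZr_LR.
Qed.

HB.instance Definition _ := @bilinear_isBilinear.Build K (hprod E) (hprod E)
  K _ _ pdot pdot_bilinear.

Let pdot_hermitian u v : pdot u v = (-1) ^+ false * theta (pdot v u).
Proof.
rewrite expr0 mul1r rmorph_sum; apply: eq_bigr => i _.
by rewrite [LHS]hermC expr0 mul1r.
Qed.

HB.instance Definition _ := @isHermitianSesquilinear.Build K (hprod E) false theta
  pdot pdot_hermitian.

Let pdot_gt0 u : u != 0 -> 0 < pdot u u.
Proof.
move=> u0; have ge0 (i : I) : 0 <= hdot (E i) (u i) (u i).
  by rewrite -hdotE exprn_ge0.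
rewrite lt0r sumr_ge0 // andbT; apply: contra u0 => /eqP pu0.
apply/eqP/hprodP => i; apply/eqP; rewrite -normr_eq0 -sqrf_eq0 hdotE.
by move/psumr_eq0P: pu0 => ->.
Qed.

HB.instance Definition _ := @isDotProduct.Build K (hprod E) pdot pdot_gt0.

End hprod_dot.

(** ** The twisted complex and the BGG complex *)

Section bgg.
Variables (K : numFieldType) (theta : {rmorphism K -> K}) (N : nat).
Variable Z : nat -> nat -> hilbertType theta.

(* [d i j], [S i j] and [P i j] are $d^{i,j}$, $S^{i,j+1}$ and $P^{i+1,j}$: an
   operator that decreases an index is indexed by the smaller value. *)
Variable d : forall i j, {linear Z i j -> Z i.+1 j}.
Variable S : forall i j, {linear Z i j.+1 -> Z i.+1 j}.
Variable P : forall i j, {linear Z i.+1 j -> Z i j}.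

Definition Ysp (i : nat) := hprod (fun j : 'I_N.+1 => Z i j : lmodType K).

Definition Ydot i : {dot Ysp i for theta} := @pdot K theta _ (fun j : 'I_N.+1 => Z i j).

(* The j-th entry of u, which is 0 when j > N. *)
Definition Yentry i (u : Ysp i) (j : nat) : Z i j :=
  match @idP (j < N.+1)%N with
  | ReflectT j_lt => u (Ordinal j_lt)
  | ReflectF _ => 0
  end.

Definition Yd i (u : Ysp i) : Ysp i.+1 := fun j => d i j (u j).
Definition YS i (u : Ysp i) : Ysp i.+1 := fun j => S i j (Yentry u j.+1).
Definition YP i (u : Ysp i.+1) : Ysp i := fun j => P i j (u j).

Definition dV i (u : Ysp i) : Ysp i.+1 := Yd u - YS u.

Definition opPS i (u : Ysp i) : Ysp i := YP (YS u).

Definition opF i (u : Ysp i) : Ysp i := \sum_(l \in [set: nat]) iter l (@opPS i) u.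
(* See [opFK] and [opFinvK]. *)
Definition opFinv i (u : Ysp i) : Ysp i := u - opPS u.

(* $P_V^{i+1}$ *)
Definition PV i (u : Ysp i.+1) : Ysp i := opF (YP (opFinv u)).

Definition kerS i : set (Ysp i) := [set u | YS u = 0].

(* $\operatorname{ran}(S^{i-1})$, with $S^{-1} = 0$ *)
Definition ranS i : set (Ysp i) :=
  match i with 0%N => [set 0] | i'.+1 => range (@YS i') end.

Definition Upsilon i : set (Ysp i) := @kerS i `&` orth (Ydot i) (@ranS i).

Definition PiUpsilon i : Ysp i -> Ysp i := oproj (Ydot i) (@Upsilon i).

(* $T^{i+1}$ and $G^{i+1}$; the operators $T^0$ and $G^0$ are zero. *)
Definition opT i (u : Ysp i.+1) : Ysp i :=
  xget 0 [set v | orth (Ydot i) (@kerS i) v /\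
                  YS v = oproj (Ydot i.+1) (@ranS i.+1) u].
Definition opG i (u : Ysp i.+1) : Ysp i :=
  - \sum_(k \in [set: nat]) iter k (fun v : Ysp i => opT (Yd v)) (opT u).

(* $d_V^{i-1} G^i$ *)
Definition dVG i : Ysp i -> Ysp i :=
  match i with 0%N => fun=> 0 | i'.+1 => fun u => dV (opG u) end.

(* The operators on [Upsilon i] are given by total functions on [Ysp i], of which
   only the restriction to [Upsilon i] is meaningful. *)
Definition bggA i (u : Ysp i) : Ysp i := u - opG (dV u).
Definition bggB i (u : Ysp i) : Ysp i := PiUpsilon (u - dVG u).
Definition bggD i (u : Ysp i) : Ysp i.+1 := PiUpsilon (dV (bggA u)).

(* $\mathscr{P}^{i+1}$ *)
Definition bggP i (u : Ysp i.+1) : Ysp i := bggB (PV (bggA u)).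

Lemma YentryE i (u : Ysp i) (j : 'I_N.+1) : Yentry u j = u j.
Proof.
case: j => j lt_j; rewrite /Yentry /=; case: {-}_ / idP => // j_lt.
by rewrite (bool_irrelevance j_lt lt_j).
Qed.

Let YentryB i (u v : Ysp i) j : Yentry (u - v) j = Yentry u j - Yentry v j.
Proof. by rewrite /Yentry; case: {-}_ / idP => // _; rewrite subr0. Qed.

Let opPSB i : {morph @opPS i : u v / u - v}.
Proof.
by move=> u v; apply: hprodP => j; rewrite /opPS /YP /YS YentryB !linearB.
Qed.

Lemma iter_opPS_eq0 i (u : Ysp i) l : (N < l)%N -> iter l (@opPS i) u = 0.
Proof.
move=> Nl; suff E (j : 'I_N.+1) : (N < l + j)%N -> iter l (@opPS i) u j = 0.
  by apply: hprodP => j; apply: E; rewrite (leq_trans Nl) // leq_addr.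
elim: l {Nl} j => [|l IHl] j; first by rewrite add0n ltnNge -ltnS ltn_ord.
rewrite addSnnS => Nlj /=; rewrite /opPS /YP /YS /Yentry.
case: {-}_ / idP => [j_lt|_]; last by rewrite !linear0.
by rewrite IHl // !linear0.
Qed.

Lemma opF_ord i (u : Ysp i) : opF u = \sum_(l < N.+1) iter l (@opPS i) u.
Proof.
rewrite fsbig_ord /opF; symmetry; apply: fsbig_widen => // l [_] /= /negP.
by rewrite -leqNgt; exact: iter_opPS_eq0.
Qed.

Let telescope_opPS i (u : Ysp i) :
  \sum_(l < N.+1) (iter l (@opPS i) u - iter l.+1 (@opPS i) u) = u.
Proof.
rewrite -(big_mkord xpredT (fun l => iter l (@opPS i) u - iter l.+1 (@opPS i) u)).
rewrite (@telescope_sumr_eq _ 0%N N.+1 (fun l => - iter l (@opPS i) u)) //.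
  by rewrite iter_opPS_eq0 // oppr0 opprK add0r.
by move=> l _; rewrite opprK addrC.
Qed.

Lemma opFK i : cancel (@opF i) (@opFinv i).
Proof.
move=> u; rewrite /opFinv opF_ord -[RHS]telescope_opPS sumrB; congr (_ - _).
have PS0 : opPS (0 : Ysp i) = 0 by rewrite -[X in opPS X](subrr 0) opPSB subrr.
have PSD : {morph @opPS i : v w / v + w}.
  by move=> v w; rewrite -[w in LHS]opprK opPSB -[- w]sub0r opPSB PS0 sub0r opprK.
by rewrite (big_morph (@opPS i) PSD PS0).
Qed.

Lemma opFinvK i : cancel (@opFinv i) (@opF i).
Proof.
move=> u; rewrite opF_ord -[RHS]telescope_opPS; apply: eq_bigr => l _.
rewrite /opFinv iterSr; elim: (l : nat) u => [|k IHk] u //=.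
by rewrite IHk opPSB -iterSr -iterS.
Qed.

End bgg.

(* Main.v *)
(* The operator G satisfies G G = 0 and G d_V G = G, so that
   p = I - d_V G - G d_V is a projection commuting with d_V.  The decomposition
   I = T S + S T + Pi (Pi the projection onto Upsilon) together with p T = T p = 0
   gives p Pi p = p.  Moreover A is the restriction of p to Upsilon, B = Pi p and
   D = Pi d_V A, hence A and B are cochain maps with B A = I, and they carry the
   homotopy P_V of the twisted complex, which is conjugate to the one of (Y, d)
   under F, to a homotopy of the BGG complex. *)
From HB Require Import structures.
Require Import Defs.
From mathcomp Require Import all_boot all_order all_algebra.
From mathcomp Require Import all_classical all_reals all_analysis.
From mathcomp Require Import ring.

Set Implicit Arguments.
Unset Strict Implicit.
Unset Printing Implicit Defensive.

Import Order.TTheory GRing.Theory Num.Theory.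
Local Open Scope classical_set_scope.
Local Open Scope ring_scope.

(** * Orthogonal projections *)

(** The order of [K] is only partial, but nonnegative elements lie on the real axis, where order
    completeness provides an infimum. For [R[i]] it is taken over real parts. *)
Lemma real_or_complex_inf (K : numFieldType) (theta : {rmorphism K -> K})
    (E : set K) :
  real_or_complex theta -> E !=set0 -> (forall x, E x -> 0 <= x) ->
  exists2 m, (forall x, E x -> m <= x) &
    forall e, 0 < e -> exists2 x, E x & x < m + e.
Proof.
move=> hK; case: hK E => R E E_neq0 E_ge0.
  have Elb : has_lbound E by exists 0 => x /E_ge0.
  exists (inf E) => [x Ex|e e_gt0]; first exact: ge_inf.
  exact: inf_adherent.
have E_Im x : E x -> complex.Im x = 0.
  by move=> /E_ge0; rewrite lecE /= => /andP[/eqP].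
have E_Re x : E x -> 0 <= complex.Re x.
  by move=> /E_ge0; rewrite lecE /= => /andP[].
set F := [set complex.Re x | x in E].
have Flb : has_lbound F by exists 0 => _ [x /E_Re + <-].
have F_neq0 : F !=set0 by case: E_neq0 => x Ex; exists (complex.Re x); exists x.
exists ((inf F)%:C)%C => [x Ex|e].
  by rewrite lecE /= E_Im // eqxx; apply: ge_inf => //; exists x.
rewrite ltcE /= => /andP[/eqP e_Im e_gt0].
have [_ [x Ex <-] xlt] := inf_adherent e_gt0 (conj F_neq0 Flb).
exists x => //; case: e e_Im {e_gt0} xlt => ? ? /= -> ?.
by rewrite ltcE /= E_Im // addr0 eqxx.
Qed.

(** * Inner products *)

Section dot_product.
Variables (K : numFieldType) (theta : {rmorphism K -> K}) (V : lmodType K).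
Variable dot : {dot V for theta}.

Lemma dotC u v : dot u v = theta (dot v u).
Proof. by rewrite hermC expr0 mul1r. Qed.

Lemma dot_ge0 u : 0 <= dot u u.
Proof.
have [->|/(neq0_dnorm_gt0 (s := dot))/ltW//] := eqVneq u 0.
by rewrite linear0l.
Qed.

Lemma dot_eq0 u : dot u u = 0 -> u = 0.
Proof.
by move=> u0; apply/eqP/negP => /negP/(neq0_dnorm_gt0 (s := dot)); rewrite u0 ltxx.
Qed.

Lemma dot0C u v : dot u v = 0 -> dot v u = 0.
Proof. by move=> uv; rewrite dotC uv rmorph0. Qed.

Lemma dot_parallelogram u v :
  dot (u + v) (u + v) + dot (u - v) (u - v) = dot u u *+ 2 + dot v v *+ 2.
Proof.
by rewrite !linearDl !linearDr /= !linearNl !linearNr /= opprK !mulr2n; ring.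
Qed.

(** The coefficient [a] gives the point of the line through [v] nearest to [x]. The gain is
    expressed by the squared length of [dot x v *: v], so that positivity of the form gives its sign
    and shows when it vanishes. *)
Lemma dot_orth_sub x v :
  v != 0 -> let a := dot x v / dot v v in
  dot (x - a *: v) (x - a *: v) =
   dot x x - dot (dot x v *: v) (dot x v *: v) / dot v v ^+ 2.
Proof.
move=> v_neq0 a; have vv_neq0 : dot v v != 0 by rewrite gt_eqF// neq0_dnorm_gt0.
have theta_vv : theta (dot v v) = dot v v by rewrite -dotC.
rewrite !linearBl !linearBr /= !linearZl_LR !linearZr_LR /=.
rewrite (dotC v x) /a rmorphM /= fmorphV theta_vv.
by rewrite /GRing.scale /=; field.
Qed.

End dot_product.

Definition linear_subspace (K : numFieldType) (V : lmodType K) (W : set V) :=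
  W 0 /\ forall (a : K) u v, W u -> W v -> W (a *: u + v).

(** * The projection theorem in a Hilbert space *)

Section projection_theorem.
Variables (K : numFieldType) (theta : {rmorphism K -> K}) (V : hilbertType theta).
Hypothesis hK : real_or_complex theta.

(** Points of [W] that nearly minimise the distance to [x] form a Cauchy filter; its limit attains
    the minimum, and minimality forces orthogonality. *)
Lemma oproj_exists (W : set V) (x : V) : linear_subspace W -> closed W ->
  exists2 y, W y & orth (hdot V) W (x - y).
Proof.
move=> [W0 Wlin] Wclosed.
pose E := [set `|x - w| ^+ 2 | w in W].
have [m E_ge E_lt] : exists2 m, (forall r, E r -> m <= r) &
    forall e, 0 < e -> exists2 r, E r & r < m + e.
  apply: real_or_complex_inf hK _ _ => [|_ [w _ <-]]; last exact: exprn_ge0.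
  by exists (`|x - 0| ^+ 2); exists 0.
have {}E_ge w : W w -> m <= `|x - w| ^+ 2 by move=> Ww; apply: E_ge; exists w.
pose A e := [set w | W w /\ `|x - w| ^+ 2 < m + e].
have A_neq0 e : 0 < e -> A e !=set0.
  by move=> /E_lt[_ [w Ww <-] xw]; exists w.
pose F := filter_from [set e : K | 0 < e] A.
have FF : ProperFilter F.
  apply: filter_from_proper => //; apply: filter_from_filter => [|e1 e2 e10 e20].
    by exists 1; exact: ltr01.
  (* Positive elements are real, hence comparable even though the order of [K] is partial. *)
  wlog le12 : e1 e2 e10 e20 / e1 <= e2.
    move=> H; have /orP[le|le] : (e1 <= e2) || (e2 <= e1).
    - by apply: real_leVge; exact: gtr0_real.
    - exact: H.
    - by rewrite setIC; exact: H.
  exists e1 => // w [Ww xw]; split; split => //.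
  by rewrite (lt_le_trans xw)// lerD2l.
(* The midpoint of [w1] and [w2] lies in [W], so its squared distance to [x] is at least [m]; the
   parallelogram law leaves less than [4 * (m + e) - 4 * m]. *)
have A_close e w1 w2 : A e w1 -> A e w2 -> `|w1 - w2| ^+ 2 < 4 * e.
  move=> [W1 x1] [W2 x2].
  have := dot_parallelogram (hdot V) (x - w1) (x - w2).
  rewrite -!hdotE addrACA.
  have Wmid : W (2^-1 *: (w1 + w2)).
    rewrite -[_ *: _]addr0; apply: (Wlin) => //.
    by rewrite -[w1]scale1r; apply: Wlin.
  have -> : x + x + (- w1 - w2) = 2 *: (x - 2^-1 *: (w1 + w2)).
    by rewrite scalerBr scalerA divff ?pnatr_eq0// scale1r scaler_nat mulr2n opprD.
  have -> : x - w1 - (x - w2) = w2 - w1 by rewrite opprB addrC addrA subrK.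
  rewrite normrZ normr_nat exprMn (distrC w2) => E4.
  have {E4} -> : `|w1 - w2| ^+ 2 = `|x - w1| ^+ 2 *+ 2 + `|x - w2| ^+ 2 *+ 2
      - 2 ^+ 2 * `|x - 2^-1 *: (w1 + w2)| ^+ 2 by rewrite -E4 addrAC subrr add0r.
  rewrite ltrBlDr.
  apply: (@lt_le_trans _ _ (4 * (m + e))).
    by rewrite -[4]/((2 + 2)%:R) natrD mulrDl !mulr_natl ltrD ?ltrMn2r.
  by rewrite mulrDr addrC lerD2l -natrX ler_pM2l ?ltr0n// E_ge.
have /cvg_ex[y FAy] : cvg F.
  apply: cauchy_cvg; apply: cauchy_exP => e e_gt0.
  have e2_gt0 : 0 < e ^+ 2 / 4 by rewrite divr_gt0 ?exprn_gt0.
  have [w Aw] := A_neq0 _ e2_gt0.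
  exists w; exists (e ^+ 2 / 4) => // w' Aw'; rewrite -ball_normE /=.
  have := A_close _ _ _ Aw Aw'; rewrite mulrC divfK ?pnatr_eq0//.
  by rewrite ltr_pXn2r ?nnegrE// ltW.
have Wy : W y.
  apply: (closed_cvg (F := F) (u_ := id) W Wclosed _ y FAy).
  by exists 1; [exact: ltr01|move=> w []].
exists y => //.
have xy_min : `|x - y| ^+ 2 <= m.
  pose a := `|x - y|; have a_ge0 : 0 <= a by exact: normr_ge0.
  (* This bound comes from a near-minimiser at distance less than [e] from [y], and the error term
     can be made arbitrarily small. *)
  suff H (e : K) : 0 < e -> e <= 1 -> a ^+ 2 <= m + (2 * a + 4) * e.
    have a1 : 0 < 2 * a + 4 by rewrite ltr_wpDl ?mulr_ge0 ?ltr0n ?ler0n.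
    (* The denominator makes both [e' <= 1] and [(2 * a + 4) * e' <= e] hold. *)
    apply/ler_addgt0Pr => e e_gt0; pose e' := e / (e + 2 * a + 4).
    have e'd : 0 < e + 2 * a + 4 by rewrite -addrA addr_gt0.
    apply: (le_trans (H e' _ _)); first by rewrite divr_gt0.
      by rewrite ler_pdivrMr// mul1r -addrA lerDl ltW.
    by rewrite lerD2l mulrCA ger_pMr// ler_pdivrMr// mul1r -addrA lerDr ltW.
  move=> e_gt0 e_le1.
  have e2_gt0 : 0 < e ^+ 2 by rewrite exprn_gt0.
  have : F (A (e ^+ 2)) by exists (e ^+ 2).
  have : F (ball y e) by apply: FAy; exact: nbhsx_ballx.
  move=> Fb FA; have [w [yw [Ww xw]]] := filter_ex (filterI Fb FA).
  move: yw; rewrite -ball_normE /= => yw.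
  have ab : a <= `|x - w| + e.
    apply: (le_trans (ler_distD w _ _)); by rewrite lerD2l distrC ltW.
  have ba : `|x - w| <= a + e.
    apply: (le_trans (ler_distD y _ _)); by rewrite lerD2l ltW.
  have ee : e ^+ 2 <= e by rewrite expr2 ger_pMr.
  have : a ^+ 2 <= (`|x - w| + e) ^+ 2 by rewrite ler_pXn2r ?nnegrE// addr_ge0// ltW.
  move=> /le_trans; apply; rewrite sqrrD -addrA.
  have -> : (2 * a + 4) * e = e + ((a + e) * e *+ 2 + e) + 2 * (e - e ^+ 2) by ring.
  apply: (@le_trans _ _ ((m + e) + ((a + e) * e *+ 2 + e))).
    rewrite lerD ?(le_trans (ltW xw)) ?lerD2l//.
    by rewrite lerD// lerMn2r ler_wpM2r// ltW.
  by rewrite -addrA lerD2l lerDl mulr_ge0// subr_ge0.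
move=> v Wv; have [->|v_neq0] := eqVneq v 0; first by rewrite linear0r.
pose c := hdot V (x - y) v; have vv_gt0 : 0 < hdot V v v by exact: neq0_dnorm_gt0.
(* Moving [y] along [v] stays in [W], so it cannot bring [y] nearer to [x]; by [dot_orth_sub] this
   forces [c *: v = 0]. *)
have : `|x - y| ^+ 2 <= `|x - y - (c / hdot V v v) *: v| ^+ 2.
  apply: (le_trans xy_min); rewrite -addrA -opprD [y + _]addrC; apply: E_ge.
  exact: Wlin.
rewrite !hdotE dot_orth_sub// lerDl oppr_ge0 pmulr_lle0 ?invr_gt0 ?exprn_gt0//.
move=> cv_le0.
have /dot_eq0/eqP : hdot V (c *: v) (c *: v) = 0.
  by apply/eqP; rewrite eq_le cv_le0 dot_ge0.
by rewrite scaler_eq0 (negbTE v_neq0) orbF => /eqP.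
Qed.
End projection_theorem.

(** * Linear subspaces and uniqueness of projections *)

Section subspaces.
Variables (K : numFieldType) (V : lmodType K).
Implicit Types (W : set V) (u v : V).

Lemma subspaceB W u v : linear_subspace W -> W u -> W v -> W (u - v).
Proof. by move=> [_ Wlin] Wu Wv; rewrite addrC -scaleN1r; exact: Wlin. Qed.

Lemma subspaceI W1 W2 : linear_subspace W1 -> linear_subspace W2 ->
  linear_subspace (W1 `&` W2).
Proof.
move=> [W10 W1lin] [W20 W2lin]; split=> // a u v [? ?] [? ?]; split.
  exact: W1lin.
exact: W2lin.
Qed.

Lemma subspace_ker (U : lmodType K) (f : {linear V -> U}) :
  linear_subspace [set x | f x = 0].
Proof.
by split=> [|a u v /= fu fv]; rewrite /= ?linear0// linearP fu fv scaler0 addr0.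
Qed.

Lemma subspace_range (U : lmodType K) (f : {linear U -> V}) :
  linear_subspace (range f).
Proof.
split=> [|a _ _ [u _ <-] [v _ <-]]; first by exists 0; rewrite ?linear0.
by exists (a *: u + v); rewrite // linearP.
Qed.

Variables (theta : {rmorphism K -> K}) (dot : {dot V for theta}).

Lemma subspace_orth W : linear_subspace (orth dot W).
Proof.
split=> [w _|a u v Wu Wv w Ww]; first by rewrite linear0l.
by rewrite linearDl linearZl_LR /= Wu// Wv// mulr0 addr0.
Qed.

Lemma orthI0 W u : W u -> orth dot W u -> u = 0.
Proof. by move=> Wu oWu; apply: (dot_eq0 (dot := dot)); exact: oWu. Qed.

Lemma oproj_unique W u v : linear_subspace W -> W v -> orth dot W (u - v) ->
  oproj dot W u = v.
Proof.
move=> Wlin Wv uv; apply: xget_unique => // v' [Wv' uv'].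
apply/eqP; rewrite -subr_eq0; apply/eqP/(orthI0 (W := W)).
  exact: subspaceB.
have -> : v' - v = (u - v) - (u - v') by rewrite opprB [RHS]addrC addrA subrK.
exact: subspaceB (subspace_orth W) uv uv'.
Qed.

Lemma oproj_spec W u : (exists2 v, W v & orth dot W (u - v)) ->
  W (oproj dot W u) /\ orth dot W (u - oproj dot W u).
Proof. by move=> [v Wv uv]; rewrite /oproj; case: xgetP => [//|/(_ v)[]]. Qed.

End subspaces.

Lemma closed_ker (K : numFieldType) (V W : normedModType K) (f : {linear V -> W}) :
  bounded_operator f -> closed [set x | f x = 0].
Proof.
move=> [M fM]; have fcont : continuous f.
  (* The bound [M] carries no sign condition, hence its norm in the witness; the product of [M] with
     the norm of [x] is nonnegative in any case. *)
  apply/bounded_linear_continuous/bounded_funP => r; exists (`|M| * r) => x xr.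
  rewrite (le_trans (fM x))//.
  have Mx : 0 <= M * `|x| by exact: le_trans (fM x).
  by rewrite -(ger0_norm Mx) normrM normr_id ler_wpM2l.
apply: (preimage_closed (D := [set 0])) => [x _|]; first exact: fcont.
by apply: accessible_closed_set1; apply: hausdorff_accessible; exact: norm_hausdorff.
Qed.

(** The product carries an inner product but no topology here, so completeness is used in each
    factor and the projection is assembled entry by entry. *)
Lemma hprod_oproj_exists (K : numFieldType) (theta : {rmorphism K -> K})
    (I : finType) (E : I -> hilbertType theta) (W : forall i, set (E i))
    (u : hprod E) :
  real_or_complex theta -> (forall i, linear_subspace (W i)) ->
  (forall i, closed (W i)) ->
  exists2 v : hprod E, (forall i, W i (v i)) &
    orth (@pdot K theta I E) [set w | forall i, W i (w i)] (u - v).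
Proof.
move=> hK Wlin Wclosed.
have projP i := oproj_spec (oproj_exists hK (u i) (Wlin i) (Wclosed i)).
exists (fun i => oproj (hdot (E i)) (W i) (u i)) => [i|w Ww].
  by have [] := projP i.
by rewrite /pdot big1 // => i _; have [_] := projP i; exact.
Qed.

(** * Algebra of the BGG construction *)

Section bgg_algebra.
Variable Y : nat -> zmodType.
Variables D S : forall i, {additive Y i -> Y i.+1}.
Variables T G : forall i, {additive Y i.+1 -> Y i}.
Variable Pi : forall i, {additive Y i -> Y i}.

Hypothesis DD : forall i (u : Y i), D _ (D _ u) = 0.
Hypothesis TT : forall i (u : Y i.+2), T _ (T _ u) = 0.
Hypothesis TST : forall i (u : Y i.+1), T _ (S _ (T _ u)) = T _ u.
Hypothesis TPi : forall i (u : Y i.+1), T _ (Pi _ u) = 0.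
Hypothesis PiT : forall i (u : Y i.+1), Pi _ (T _ u) = 0.
Hypothesis PiK : forall i (u : Y i), Pi _ (Pi _ u) = Pi _ u.
Hypothesis TS0 : forall u : Y 0%N, u = T _ (S _ u) + Pi _ u.
Hypothesis TSST : forall i (u : Y i.+1), u = T _ (S _ u) + S _ (T _ u) + Pi _ u.
(** Here [D] stands for d_V, so [D + S] is d. The two recursions split off the first term of the
    series of G and factor T d out of the rest on the left, respectively d T on the right. *)
Hypothesis GTl : forall i (u : Y i.+1),
  G _ u = T _ (D _ (G _ u) + S _ (G _ u)) - T _ u.
Hypothesis GTr : forall i (u : Y i.+1),
  G _ u = G _ (D _ (T _ u) + S _ (T _ u)) - T _ u.

Definition DV_G i : Y i -> Y i :=
  match i with 0%N => fun=> 0 | i'.+1 => fun u => D _ (G _ u) end.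

(* The projection onto the subcomplex of Y isomorphic to the BGG complex. *)
Definition bgg_proj i (u : Y i) := u - DV_G u - G _ (D _ u).

Lemma bgg_proj_is_zmod_morphism i : zmod_morphism (@bgg_proj i).
Proof.
have DV_GB : {morph @DV_G i : u v / u - v}.
  by case: i => [|i] u v /=; rewrite ?subr0// !raddfB.
move=> u v; rewrite /bgg_proj DV_GB !raddfB /=.
by rewrite [RHS]addrACA (addrACA u).
Qed.

HB.instance Definition _ i :=
  GRing.isZmodMorphism.Build (Y i) (Y i) (@bgg_proj i)
    (@bgg_proj_is_zmod_morphism i).

Lemma bgg_projD i : {morph @bgg_proj i : u v / u + v}. Proof. exact: raddfD. Qed.

Lemma GinT i (u : Y i.+1) : exists x, G _ u = T _ x.
Proof. by exists (D _ (G _ u) + S _ (G _ u) - u); rewrite raddfB -GTl. Qed.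

(** G takes values in the range of T, and [GTr] shows that G vanishes on that range because T T =
    0. *)
Lemma GG i (u : Y i.+2) : G _ (G _ u) = 0.
Proof.
by have [x ->] := GinT u; rewrite GTr TT !(raddf0, addr0).
Qed.

(** On the range of T, hence on that of G, the operator T S is the identity. So [GTr] at S G u
    contains G S G u on both sides, and cancelling it leaves the claim. *)
Lemma GDG i (u : Y i.+1) : G _ (D _ (G _ u)) = G _ u.
Proof.
have TSG : T _ (S _ (G _ u)) = G _ u by have [x ->] := GinT u; rewrite TST.
have := GTr (S _ (G _ u)); rewrite TSG raddfD addrAC => /eqP.
by rewrite -subr_eq subrr eq_sym subr_eq0 => /eqP.
Qed.

Lemma bgg_projG i (u : Y i.+1) : bgg_proj (G _ u) = 0.
Proof.
by case: i u => [|i] u; rewrite /bgg_proj /= ?GG GDG !(raddf0, addr0) subrr.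
Qed.

(** By [GTr], every value of T is also a value of G, and [bgg_projG] applies. *)
Lemma bgg_projT i (u : Y i.+1) : bgg_proj (T _ u) = 0.
Proof.
suff -> : T _ u = G _ (D _ (T _ u) + S _ (T _ u) - u) by rewrite bgg_projG.
by rewrite raddfB [G _ u]GTr opprB addrC subrK.
Qed.

Lemma G_bgg_proj i (u : Y i.+1) : G _ (bgg_proj u) = 0.
Proof. by rewrite /bgg_proj !raddfB /= GDG GG subrr subr0. Qed.

(** Once G annihilates the projection, every term of [GTl] except the last one vanishes. *)
Lemma T_bgg_proj i (u : Y i.+1) : T _ (bgg_proj u) = 0.
Proof.
have := GTl (bgg_proj u); rewrite G_bgg_proj !(raddf0, addr0) sub0r => /eqP.
by rewrite eq_sym oppr_eq0 => /eqP.
Qed.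

Lemma D_bgg_proj i (u : Y i) : D _ (bgg_proj u) = bgg_proj (D _ u).
Proof.
by case: i u => [|i] u; rewrite /bgg_proj /= !raddfB /= !(DD, raddf0, addr0).
Qed.

Lemma bgg_projK i (u : Y i) : bgg_proj (bgg_proj u) = bgg_proj u.
Proof.
have E : bgg_proj u = u - DV_G u - G _ (D _ u) by [].
rewrite [in LHS]E !bgg_proj_is_zmod_morphism bgg_projG subr0.
by case: i u {E} => [|i] u /=; rewrite -?D_bgg_proj ?bgg_projG !(raddf0, addr0).
Qed.

(** In the decomposition of p u, the term S T p u vanishes since T p = 0, and p annihilates the term
    T S p u. Thus p recovers its values from their components in Upsilon. *)
Lemma bgg_proj_Pi_bgg_proj i (u : Y i) : bgg_proj (Pi _ (bgg_proj u)) = bgg_proj u.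
Proof.
have E : bgg_proj u = T _ (S _ (bgg_proj u)) + Pi _ (bgg_proj u).
  case: i u => [|i] u; first exact: TS0.
  by rewrite [LHS]TSST T_bgg_proj !(raddf0, addr0).
by rewrite -[RHS]bgg_projK [X in _ = bgg_proj X]E bgg_projD bgg_projT add0r.
Qed.

Lemma DV_G_Pi i (u : Y i) : Pi _ u = u -> DV_G u = 0.
Proof.
by case: i u => [|i] u //= <-; rewrite GTr TPi !(raddf0, addr0).
Qed.

Lemma bgg_proj_Pi_fixed i (u : Y i) : Pi _ u = u -> u - G _ (D _ u) = bgg_proj u.
Proof. by move=> Piu; rewrite /bgg_proj DV_G_Pi// subr0. Qed.

Lemma PiG i (u : Y i.+1) : Pi _ (G _ u) = 0.
Proof. by have [x ->] := GinT u. Qed.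

Lemma Pi_bgg_proj i (u : Y i) : Pi _ (u - DV_G u) = Pi _ (bgg_proj u).
Proof. by rewrite /bgg_proj [in RHS]raddfB /= PiG subr0. Qed.

(** * Transfer of a homotopy to the BGG complex *)

Variable P : forall i, {additive Y i.+1 -> Y i}.
Hypothesis DP : forall i (u : Y i.+1), D _ (P _ u) + P _ (D _ u) = u.
Hypothesis DPD : forall u : Y 0%N, D _ (P _ (D _ u)) = D _ u.

Definition embed i (u : Y i) := u - G _ (D _ u).
Definition restrict i (u : Y i) := Pi _ (u - DV_G u).
Definition bgg_diff i (u : Y i) := Pi _ (D _ (embed u)).

Lemma bgg_diffE i (u : Y i) : Pi _ u = u -> bgg_diff u = Pi _ (D _ (bgg_proj u)).
Proof. by move=> uP; rewrite /bgg_diff /embed bgg_proj_Pi_fixed. Qed.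

(** As p commutes with D, the right-hand side is also [restrict (D _ u)]: this is the cochain map
    property of B. *)
Lemma bgg_diff_restrict i (u : Y i) :
  bgg_diff (restrict u) = Pi _ (D _ (bgg_proj u)).
Proof. by rewrite bgg_diffE /restrict Pi_bgg_proj ?PiK// bgg_proj_Pi_bgg_proj. Qed.

(** The cochain map property of A, whose values on Upsilon are those of p. *)
Lemma embed_bgg_diff i (u : Y i) : Pi _ u = u ->
  embed (bgg_diff u) = D _ (bgg_proj u).
Proof.
move=> uP; rewrite bgg_diffE// /embed bgg_proj_Pi_fixed ?PiK//.
by rewrite D_bgg_proj bgg_proj_Pi_bgg_proj.
Qed.

(** Moving the differentials through A and B turns the sum into B (D P + P D) A = B A, and B A is
    the identity on Upsilon because p p = p and G vanishes on Upsilon. *)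
Lemma bgg_homotopy i (u : Y i.+1) : Pi _ u = u ->
  bgg_diff (restrict (P _ (embed u))) + restrict (P _ (embed (bgg_diff u))) = u.
Proof.
move=> uP; rewrite bgg_diff_restrict embed_bgg_diff// /restrict Pi_bgg_proj.
rewrite D_bgg_proj /embed bgg_proj_Pi_fixed// -raddfD -bgg_projD DP bgg_projK.
by rewrite -Pi_bgg_proj DV_G_Pi// subr0.
Qed.

Lemma bgg_homotopy0 (u : Y 0%N) : Pi _ u = u ->
  bgg_diff (restrict (P _ (embed (bgg_diff u)))) = bgg_diff u.
Proof.
move=> uP; rewrite bgg_diff_restrict embed_bgg_diff// D_bgg_proj DPD.
by rewrite -D_bgg_proj bgg_projK bgg_diffE.
Qed.

End bgg_algebra.

(** * Operators on the product spaces *)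

Section entries.
Variables (K : numFieldType) (theta : {rmorphism K -> K}) (N : nat).
Variable Z : nat -> nat -> hilbertType theta.

Lemma Yentry_linear i j (a : K) (u v : Ysp N Z i) :
  Yentry (a *: u + v) j = a *: Yentry u j + Yentry v j.
Proof. by rewrite /Yentry; case: {-}_ / idP => // _; rewrite scaler0 addr0. Qed.

Lemma Yentry_fun i j (w : forall j, Z i j) : (j < N.+1)%N ->
  Yentry ((fun j : 'I_N.+1 => w j) : Ysp N Z i) j = w j.
Proof. by move=> jN; exact: (YentryE _ (Ordinal jN)). Qed.

Lemma Yentry_out i j (u : Ysp N Z i) : (N < j)%N -> Yentry u j = 0.
Proof. by rewrite /Yentry; case: {-}_ / idP => // jN; rewrite ltnNge -ltnS jN. Qed.

End entries.

Section twisted_complex.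
Variables (K : numFieldType) (theta : {rmorphism K -> K}) (N : nat).
Variable Z : nat -> nat -> hilbertType theta.
Variable d : forall i j, {linear Z i j -> Z i.+1 j}.
Variable S : forall i j, {linear Z i j.+1 -> Z i.+1 j}.
Variable P : forall i j, {linear Z i.+1 j -> Z i j}.
Local Notation Y := (Ysp N Z).

Lemma Yd_is_linear i : linear (@Yd _ _ N _ d i).
Proof. by move=> a u v; apply: hprodP => j; exact: linearP. Qed.
HB.instance Definition _ i := GRing.isLinear.Build K (Y i) (Y i.+1) _
  (@Yd _ _ N _ d i) (@Yd_is_linear i).

Lemma YP_is_linear i : linear (@YP _ _ N _ P i).
Proof. by move=> a u v; apply: hprodP => j; exact: linearP. Qed.
HB.instance Definition _ i := GRing.isLinear.Build K (Y i.+1) (Y i) _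
  (@YP _ _ N _ P i) (@YP_is_linear i).

Lemma YS_is_linear i : linear (@YS _ _ N _ S i).
Proof.
by move=> a u v; apply: hprodP => j; rewrite /YS Yentry_linear; exact: linearP.
Qed.
HB.instance Definition _ i := GRing.isLinear.Build K (Y i) (Y i.+1) _
  (@YS _ _ N _ S i) (@YS_is_linear i).

Lemma dV_is_zmod_morphism i : zmod_morphism (@dV _ _ N _ d S i).
Proof. by move=> u v; rewrite /dV !linearB addrACA. Qed.
HB.instance Definition _ i := GRing.isZmodMorphism.Build (Y i) (Y i.+1)
  (@dV _ _ N _ d S i) (@dV_is_zmod_morphism i).

Lemma YS_entry i (u : Y i) j : (j <= N)%N ->
  Yentry (YS S u) j = S i j (Yentry u j.+1).
Proof. by move=> jN; rewrite (Yentry_fun (fun j => S i j (Yentry u j.+1))). Qed.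

Lemma Yd_entry i (u : Y i) j : Yentry (Yd d u) j = d i j (Yentry u j).
Proof. by rewrite /Yentry; case: {-}_ / idP => // _; rewrite linear0. Qed.

Lemma opFinv_is_zmod_morphism i : zmod_morphism (@opFinv _ _ N _ S P i).
Proof. by move=> u v; rewrite /opFinv /opPS !linearB addrACA. Qed.

Lemma opF_is_zmod_morphism i : zmod_morphism (@opF _ _ N _ S P i).
Proof.
move=> u v; apply: (can_inj (@opFinvK _ _ _ _ S P i)).
by rewrite opFinv_is_zmod_morphism !opFK.
Qed.

HB.instance Definition _ i := GRing.isZmodMorphism.Build (Y i) (Y i)
  (@opF _ _ N _ S P i) (@opF_is_zmod_morphism i).

Lemma PV_is_zmod_morphism i : zmod_morphism (@PV _ _ N _ S P i).
Proof.
by move=> u v; rewrite /PV opFinv_is_zmod_morphism linearB opF_is_zmod_morphism.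
Qed.

HB.instance Definition _ i := GRing.isZmodMorphism.Build (Y i.+1) (Y i)
  (@PV _ _ N _ S P i) (@PV_is_zmod_morphism i).

Hypothesis SS : forall i j (x : Z i j.+2), S i.+1 j (S i j.+1 x) = 0.

Lemma YSYS i (u : Y i) : YS S (YS S u) = 0.
Proof.
(* At the last index [j = N], the outer S reads the entry [N + 1], which is 0 by convention. *)
apply: hprodP => j; rewrite {1}/YS; case: (ltnP N j.+1) => jN.
  by rewrite Yentry_out// linear0.
by rewrite YS_entry//; exact: SS.
Qed.

(** * The homotopy of the twisted complex *)

Section homotopy.
Hypothesis dd : forall i j (x : Z i j), d i.+1 j (d i j x) = 0.
Hypothesis dS : forall i j (x : Z i j.+1),
  d i.+1 j (S i j x) = - S i.+1 j (d i j.+1 x).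
Hypothesis dP : forall i j (x : Z i.+1 j),
  d i j (P i j x) + P i.+1 j (d i.+1 j x) = x.
Hypothesis dPd : forall j (x : Z 0%N j),
  d 0%N j (P 0%N j (d 0%N j x)) = d 0%N j x.

Lemma YdYd i (u : Y i) : Yd d (Yd d u) = 0.
Proof. by apply: hprodP => j; exact: dd. Qed.

Lemma YdYS i (u : Y i) : Yd d (YS S u) = - YS S (Yd d u).
Proof. by apply: hprodP => j; rewrite hprodN /YS Yd_entry; exact: dS. Qed.

Lemma YdYP i (u : Y i.+1) : Yd d (YP P u) + YP P (Yd d u) = u.
Proof. by apply: hprodP => j; exact: dP. Qed.

Lemma YdYPYd (u : Y 0%N) : Yd d (YP P (Yd d u)) = Yd d u.
Proof. by apply: hprodP => j; exact: dPd. Qed.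

Lemma dVdV i (u : Y i) : dV d S (dV d S u) = 0.
Proof.
rewrite /dV [Yd d (_ - _)]linearB [YS S (_ - _)]linearB /=.
by rewrite YdYd YSYS YdYS sub0r opprK subr0 subrr.
Qed.

(** Since S S = 0, the left side is d - S - P S d. Inserting S = d P S + P d S and d S = - S d
    cancels the terms P S d and leaves d - d P S. Hence F conjugates d into d_V. *)
Lemma opFinv_dV i (u : Y i) : opFinv S P (dV d S u) = Yd d (opFinv S P u).
Proof.
rewrite /opFinv /opPS /dV [YS S (_ - _)]linearB.
rewrite [Yd d (_ - YP _ _)]linearB /= YSYS subr0.
rewrite -[in LHS](YdYP (YS S u)) YdYS linearN /=.
by rewrite opprD opprK addrA addrK.
Qed.

Lemma dV_opF i (u : Y i) : dV d S (opF S P u) = opF S P (Yd d u).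
Proof. by rewrite -[LHS](opFinvK S P) opFinv_dV opFK. Qed.

Lemma dV_PV i (u : Y i.+1) :
  dV d S (PV S P u) + PV S P (dV d S u) = u.
Proof.
by rewrite /PV dV_opF opFinv_dV -raddfD /= YdYP opFinvK.
Qed.

Lemma dV_PV_dV (u : Y 0%N) : dV d S (PV S P (dV d S u)) = dV d S u.
Proof.
by rewrite /PV dV_opF opFinv_dV YdYPYd -opFinv_dV opFinvK.
Qed.

End homotopy.

(** * Kernels, ranges and the Hodge-type decomposition *)

Section projections.
Hypothesis hK : real_or_complex theta.
Hypothesis Z_gtN : forall i j, (N < j)%N -> forall x : Z i j, x = 0.
Hypothesis S_bounded : forall i j, bounded_operator (S i j).
Hypothesis S_closed : forall i j, closed (range (S i j)).

(** The operator on the product never reads the entry of index 0, which is therefore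
    unconstrained. *)
Definition kerS_entry i j : set (Z i j) :=
  match j with 0%N => setT | j'.+1 => [set x | S i j' x = 0] end.

Lemma kerSP i (u : Y i) : kerS S u <-> forall j : 'I_N.+1, kerS_entry (u j).
Proof.
split=> [Su [j jN]|Su].
  rewrite -[u _]YentryE /=; case: j jN => // j jN /=.
  rewrite -YS_entry; last exact: ltnW.
  by rewrite (Su : YS S u = 0) /Yentry; case: {-}_ / idP.
apply: hprodP => j; rewrite /YS hprod0; case: (ltnP N j.+1) => jN.
  by rewrite Yentry_out// linear0.
by have := Su (Ordinal (jN : j.+1 < N.+1)%N); rewrite -YentryE.
Qed.

(** Preimages are chosen entrywise and shifted by one index. For [j = N] the source space is zero,
    so the last entry is 0 on both sides. *)
Lemma ranSP i (u : Y i.+1) :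
  ranS S u <-> forall j : 'I_N.+1, range (S i j) (u j).
Proof.
split=> [[v _ <-] j|ran_u]; first by exists (Yentry v j.+1).
pose w j : Z i j := match j with
  0%N => 0 | j'.+1 => xget 0 [set x | S i j' x = Yentry u j'] end.
exists (fun j : 'I_N.+1 => w j) => //; apply: hprodP => j; rewrite /YS.
have [x _ Sx] := ran_u j; case: (ltnP N j.+1) => jN.
  by rewrite Yentry_out// -Sx (Z_gtN jN x).
rewrite (Yentry_fun w)//= -[RHS]YentryE; case: xgetP => // /(_ x).
by rewrite /= YentryE Sx.
Qed.

Lemma kerS_subspace i : linear_subspace (@kerS _ _ N _ S i).
Proof. exact: subspace_ker. Qed.

Lemma ranS_subspace i : linear_subspace (@ranS _ _ N _ S i).
Proof.
case: i => [|i]; last exact: subspace_range.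
by split=> // a _ _ -> ->; rewrite /= scaler0 addr0.
Qed.

Lemma Upsilon_subspace i : linear_subspace (@Upsilon _ _ N _ S i).
Proof. apply: subspaceI; [exact: kerS_subspace|exact: subspace_orth]. Qed.

Lemma ranS_sub_kerS i : @ranS _ _ N _ S i `<=` @kerS _ _ N _ S i.
Proof.
by case: i => [|i] u /=; [move=> ->; exact: linear0|case=> v _ <-; exact: YSYS].
Qed.

Lemma kerS_proj i (u : Y i) :
  exists2 v, kerS S v & orth (Ydot N Z i) (kerS S (i := i)) (u - v).
Proof.
have [//| |v Wv uv] :=
  @hprod_oproj_exists _ _ _ _ (fun j : 'I_N.+1 => @kerS_entry i j) u hK.
- by case=> -[|j] jN; [split|exact: subspace_ker].
- by case=> -[|j] jN; [exact: closedT|exact: closed_ker (S_bounded _ _)].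
exists v => [|w /kerSP Ww]; first exact/kerSP.
exact: uv.
Qed.

Lemma ranS_proj i (u : Y i) :
  exists2 v, ranS S v & orth (Ydot N Z i) (ranS S (i := i)) (u - v).
Proof.
case: i u => [|i] u.
  by exists 0 => // _ ->; rewrite linear0r.
have [||v Wv uv] :=
  @hprod_oproj_exists _ _ _ _ (fun j : 'I_N.+1 => range (S i j)) u hK.
- by move=> j; exact: subspace_range.
- by move=> j; exact: S_closed.
exists v => [|w /ranSP Ww]; first exact/ranSP.
exact: uv.
Qed.

(** Projecting onto ker S and then removing the component in ran S works because ran S is contained
    in ker S. *)
Lemma Upsilon_proj i (u : Y i) : exists2 v, Upsilon S v &
  orth (Ydot N Z i) (Upsilon S (i := i)) (u - v).
Proof.
have [k kk uk] := kerS_proj u; have [r rr kr] := ranS_proj k.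
exists (k - r).
  split=> //; apply: subspaceB (@kerS_subspace i) kk _; exact: ranS_sub_kerS.
move=> w [kw rw]; rewrite opprB addrCA addrC linearDl /= uk// add0r.
exact/dot0C/rw.
Qed.

Lemma PiUpsilon_spec i (u : Y i) : Upsilon S (PiUpsilon S u) /\
  orth (Ydot N Z i) (Upsilon S (i := i)) (u - PiUpsilon S u).
Proof. exact/oproj_spec/Upsilon_proj. Qed.

Lemma PiUpsilon_unique i (u v : Y i) : Upsilon S v ->
  orth (Ydot N Z i) (Upsilon S (i := i)) (u - v) -> PiUpsilon S u = v.
Proof. exact/oproj_unique/Upsilon_subspace. Qed.

Lemma PiUpsilon_id i (u : Y i) : Upsilon S u -> PiUpsilon S u = u.
Proof.
move=> Uu; apply: PiUpsilon_unique => //.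
by rewrite subrr; case: (subspace_orth (Ydot N Z i) (Upsilon S (i := i))).
Qed.

Lemma PiUpsilon_eq0 i (u : Y i) :
  orth (Ydot N Z i) (Upsilon S (i := i)) u -> PiUpsilon S u = 0.
Proof.
move=> ou; apply: PiUpsilon_unique; last by rewrite subr0.
by case: (@Upsilon_subspace i).
Qed.

Lemma PiUpsilon_is_zmod_morphism i : zmod_morphism (@PiUpsilon _ _ N _ S i).
Proof.
move=> u v; have [Uu ou] := PiUpsilon_spec u; have [Uv ov] := PiUpsilon_spec v.
apply: PiUpsilon_unique; first exact: subspaceB (@Upsilon_subspace i) Uu Uv.
have -> : u - v - (PiUpsilon S u - PiUpsilon S v) =
    (u - PiUpsilon S u) - (v - PiUpsilon S v) by rewrite !opprD addrACA.
exact: subspaceB (subspace_orth _ _) ou ov.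
Qed.

(** T is the Moore-Penrose inverse of S: [opT S u] is the least-squares solution of S v = u
    orthogonal to ker S. The later facts on T rest on this characterisation. *)
Lemma opT_unique i (u : Y i.+1) (v : Y i) :
  orth (Ydot N Z i) (kerS S (i := i)) v ->
  orth (Ydot N Z i.+1) (ranS S (i := i.+1)) (u - YS S v) -> opT S u = v.
Proof.
move=> kv ruv; apply: xget_unique => [|v' [kv' Sv']].
  by split=> //; apply/esym/oproj_unique => //; [exact: ranS_subspace|exists v].
apply/eqP; rewrite -subr_eq0; apply/eqP.
apply: (orthI0 (dot := Ydot N Z i) (W := kerS S (i := i))).
  rewrite /kerS /= linearB /= Sv'; apply/eqP; rewrite subr_eq0.
  apply/eqP/oproj_unique => //.
    exact: ranS_subspace.
  by exists v.
exact: subspaceB (subspace_orth _ _) kv' kv.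
Qed.

Lemma opT_spec i (u : Y i.+1) :
  orth (Ydot N Z i) (kerS S (i := i)) (opT S u) /\
  orth (Ydot N Z i.+1) (ranS S (i := i.+1)) (u - YS S (opT S u)).
Proof.
(* A preimage [v] of the projection of [u] onto ran S becomes orthogonal to ker S once its kernel
   component [k] is removed. *)
have [_ [v _ <-] uv] := ranS_proj u; have [k kk vk] := kerS_proj v.
suff -> : opT S u = v - k by rewrite linearB /= (kk : YS S k = 0) subr0.
by apply: opT_unique => //; rewrite linearB /= (kk : YS S k = 0) subr0.
Qed.

Lemma opT_is_zmod_morphism i : zmod_morphism (@opT _ _ N _ S i).
Proof.
move=> u v; have [ku ou] := opT_spec u; have [kv ov] := opT_spec v.
apply: opT_unique; first exact: subspaceB (subspace_orth _ _) ku kv.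
have -> : u - v - YS S (opT S u - opT S v) =
    (u - YS S (opT S u)) - (v - YS S (opT S v)).
  by rewrite [YS S (_ - _)]linearB !opprD addrACA.
exact: subspaceB (subspace_orth _ _) ou ov.
Qed.

Lemma opT_eq0 i (u : Y i.+1) :
  orth (Ydot N Z i.+1) (ranS S (i := i.+1)) u -> opT S u = 0.
Proof.
move=> ou; apply: opT_unique.
  by case: (subspace_orth (Ydot N Z i) (kerS S (i := i))).
by rewrite linear0 subr0.
Qed.

Lemma orth_kerS_ranS i (u : Y i) : orth (Ydot N Z i) (kerS S (i := i)) u ->
  orth (Ydot N Z i) (ranS S (i := i)) u.
Proof. by move=> ou w /ranS_sub_kerS; exact: ou. Qed.

Lemma opT_opT i (u : Y i.+2) : opT S (opT S u) = 0.
Proof. by apply/opT_eq0/orth_kerS_ranS; case: (opT_spec u). Qed.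

Lemma opT_YS i (u : Y i) : orth (Ydot N Z i) (kerS S (i := i)) u ->
  opT S (YS S u) = u.
Proof.
move=> ou; apply: opT_unique => //; rewrite subrr.
by case: (subspace_orth (Ydot N Z i.+1) (ranS S (i := i.+1))).
Qed.

Lemma opT_Pi i (u : Y i.+1) : opT S (PiUpsilon S u) = 0.
Proof. by apply: opT_eq0; have [[]] := PiUpsilon_spec u. Qed.

Lemma Pi_opT i (u : Y i.+1) : PiUpsilon S (opT S u) = 0.
Proof.
by apply: PiUpsilon_eq0 => w [kw _]; have [+ _] := opT_spec u; exact.
Qed.

Lemma kerS_sub_opT_YS i (u : Y i) : kerS S (u - opT S (YS S u)).
Proof.
have [k kk uk] := kerS_proj u.
have -> : YS S u = YS S (u - k) by rewrite linearB /= (kk : YS S k = 0) subr0.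
by rewrite opT_YS// opprB addrC subrK.
Qed.

Lemma Pi_YS i (u : Y i) : PiUpsilon S (YS S u) = 0.
Proof.
apply: PiUpsilon_eq0 => w [_ rw]; apply/dot0C/rw.
by exists u.
Qed.

Lemma hodge_decomposition0 (u : Y 0%N) : u = opT S (YS S u) + PiUpsilon S u.
Proof.
have Uu : Upsilon S (u - opT S (YS S u)).
  by split=> [|_ ->]; [exact: kerS_sub_opT_YS|exact: linear0r].
have := PiUpsilon_id Uu; rewrite PiUpsilon_is_zmod_morphism Pi_opT subr0 => ->.
by rewrite addrC subrK.
Qed.

(** Subtracting T S u from [u] lands in ker S; subtracting then the projection S T u onto ran S
    lands in Upsilon. The result equals its own projection, and that is [PiUpsilon S u] because the
    projection annihilates the values of T and S. *)
Lemma hodge_decomposition i (u : Y i.+1) :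
  u = opT S (YS S u) + YS S (opT S u) + PiUpsilon S u.
Proof.
set k := u - opT S (YS S u).
have Tk : opT S k = opT S u by rewrite opT_is_zmod_morphism opT_opT subr0.
have Uk : Upsilon S (k - YS S (opT S k)).
  split; last by have [] := opT_spec k.
  apply: subspaceB (@kerS_subspace i.+1) _ _; first exact: kerS_sub_opT_YS.
  exact: YSYS.
have := PiUpsilon_id Uk.
rewrite !PiUpsilon_is_zmod_morphism Pi_opT Pi_YS !subr0 Tk => ->.
by rewrite -addrA [YS _ _ + _]addrC subrK addrC subrK.
Qed.

(** * Nilpotency of T d and the series for G *)

Definition zero_below l i (u : Y i) := forall j : 'I_N.+1, (j < l)%N -> u j = 0.

Lemma Yd_zero_below l i (u : Y i) : zero_below l u -> zero_below l (Yd d u).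
Proof. by move=> u0 j jl; rewrite /Yd u0// linear0. Qed.

(** T is defined on the whole product, so its raising of the index has to be derived: the truncation
    [w] of T u to the entries up to [l] lies in ker S, to which T u is orthogonal. *)
Lemma opT_zero_below l i (u : Y i.+1) :
  zero_below l u -> zero_below l.+1 (opT S u).
Proof.
set v := opT S u => u0; have [kv ov] : orth (Ydot N Z i) (kerS S (i := i)) v /\ _ :=
  opT_spec u.
pose w : Y i := fun j => if (j < l.+1)%N then v j else 0.
have w_entry j : Yentry w j = if (j < l.+1)%N then Yentry v j else 0.
  by rewrite /Yentry; case: {-}_ / idP => // _; rewrite if_same.
have Sw j : YS S w j = if (j < l)%N then YS S v j else 0.
  by rewrite /YS w_entry ltnS; case: ifP => // _; rewrite linear0.
have kw : YS S w = 0.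
  apply: (dot_eq0 (dot := Ydot N Z i.+1)).
  (* [YS S w] is [YS S v] cut off at [l], where [u] vanishes. Pairing it with [u - YS S v] therefore
     gives minus its own squared length, and this pairing is 0. *)
  have /eqP := ov (YS S w) (ex_intro2 _ _ w I erefl).
  rewrite -oppr_eq0 => /eqP <-; rewrite /= /pdot -sumrN; apply: eq_bigr => j _.
  rewrite hprodD hprodN Sw; case: ifP => [jl|_]; last by rewrite !linear0r oppr0.
  by rewrite (u0 j jl) sub0r linearNl opprK.
suff w0 : w = 0.
  by move=> j jl; rewrite -[RHS](congr1 (fun w : Y i => w j) w0) /w jl.
apply: (dot_eq0 (dot := Ydot N Z i)); rewrite -(kv w kw) /= /pdot.
by apply: eq_bigr => j _; rewrite /w; case: ifP => // _; rewrite !linear0r.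
Qed.

Lemma iter_opT_Yd_eq0 i (u : Y i.+1) k : (N <= k)%N ->
  iter k (fun v : Y i => opT S (Yd d v)) (opT S u) = 0.
Proof.
move=> Nk.
suff low : zero_below k.+1
    (iter k (fun v : Y i => opT S (Yd d v)) (opT S u)).
  by apply: hprodP => j; apply: low; rewrite (leq_trans (ltn_ord j)).
elim: k {Nk} => [|k IHk] /=; first exact: opT_zero_below.
exact/opT_zero_below/Yd_zero_below.
Qed.

(** The length [n] is left free so that the recursions can compare a sum of [N + 1] terms with one
    of [N] terms. *)
Lemma opG_sum n i (u : Y i.+1) : (N <= n)%N ->
  opG d S u = - \sum_(k < n) iter k (fun v : Y i => opT S (Yd d v)) (opT S u).
Proof.
move=> Nn; rewrite fsbig_ord /opG; congr (- _); symmetry; apply: fsbig_widen => // k.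
move=> [_] /= /negP; rewrite -leqNgt => nk.
by apply: iter_opT_Yd_eq0; exact: leq_trans nk.
Qed.

Lemma opT0 i : opT S (0 : Y i.+1) = 0.
Proof. by rewrite -(subrr 0) opT_is_zmod_morphism subrr. Qed.

Lemma opG_opT_Yd i (u : Y i.+1) :
  opG d S u = opG d S (Yd d (opT S u)) - opT S u.
Proof.
rewrite (opG_sum _ (leqnSn N)) (opG_sum _ (leqnn N)) big_ord_recl opprD addrC.
by congr (- _ - _); apply: eq_bigr => k _; rewrite -iterSr.
Qed.

Lemma opT_Yd_opG i (u : Y i.+1) :
  opG d S u = opT S (Yd d (opG d S u)) - opT S u.
Proof.
rewrite {1}(opG_sum _ (leqnSn N)) (opG_sum _ (leqnn N)) big_ord_recl opprD addrC.
congr (_ - _).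
have opTN (v : Y i.+1) : opT S (- v) = - opT S v.
  by rewrite -sub0r opT_is_zmod_morphism opT0 sub0r.
have opTD : {morph @opT _ _ N _ S i : u v / u + v}.
  by move=> v w; rewrite -[w in LHS]opprK opT_is_zmod_morphism opTN opprK.
rewrite [Yd d _]linearN /= opTN [Yd d _]linear_sum.
by rewrite (big_morph (@opT _ _ N _ S i) opTD (@opT0 i)).
Qed.

Lemma opG_is_zmod_morphism i : zmod_morphism (@opG _ _ N _ d S i).
Proof.
move=> u v; rewrite !(opG_sum _ (leqnn N)) -opprD -sumrB; congr (- _).
apply: eq_bigr => k _; elim: (k : nat) => [|m IHm] /=.
  exact: opT_is_zmod_morphism.
by rewrite IHm linearB opT_is_zmod_morphism.
Qed.

End projections.
End twisted_complex.

Theorem theorem3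
  (K : numFieldType) (theta : {rmorphism K -> K}) (hK : real_or_complex theta)
  (n N : nat) (Z : nat -> nat -> hilbertType theta)
  (Z0 : forall i j, (n < i)%N || (N < j)%N -> forall x : Z i j, x = 0)
  (d : forall i j, {linear Z i j -> Z i.+1 j})
  (S : forall i j, {linear Z i j.+1 -> Z i.+1 j})
  (P : forall i j, {linear Z i.+1 j -> Z i j})
  (d_bounded : forall i j, bounded_operator (d i j))
  (S_bounded : forall i j, bounded_operator (S i j))
  (P_bounded : forall i j, bounded_operator (P i j))
  (dd : forall i j (x : Z i j), d i.+1 j (d i j x) = 0)
  (dS : forall i j (x : Z i j.+1), d i.+1 j (S i j x) = - S i.+1 j (d i j.+1 x))
  (SS : forall i j (x : Z i j.+2), S i.+1 j (S i j.+1 x) = 0)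
  (dP : forall i j (x : Z i.+1 j), d i j (P i j x) + P i.+1 j (d i.+1 j x) = x)
  (dPd : forall j (x : Z 0%N j), d 0%N j (P 0%N j (d 0%N j x)) = d 0%N j x)
  (S_closed : forall i j, closed (range (S i j))) :
  (forall i (u : Ysp N Z i.+1), Upsilon S u ->
     bggD d S (bggP d S P u) + bggP d S P (bggD d S u) = u) /\
  (forall u : Ysp N Z 0%N, Upsilon S u ->
     bggD d S (bggP d S P (bggD d S u)) = bggD d S u).
Proof.
have Z_gtN i j : (N < j)%N -> forall x : Z i j, x = 0.
  by move=> Nj; apply: Z0; rewrite Nj orbT.
(* Additivity of T, G and the projection depends on closed ranges and boundedness, so the additive
   structures are built here rather than declared globally. *)
have TB i : zmod_morphism (@opT _ _ N _ S i) by exact: opT_is_zmod_morphism.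
have GB i : zmod_morphism (@opG _ _ N _ d S i) by exact: opG_is_zmod_morphism.
have PiB i : zmod_morphism (@PiUpsilon _ _ N _ S i).
  exact: PiUpsilon_is_zmod_morphism.
pose T i : {additive Ysp N Z i.+1 -> Ysp N Z i} :=
  HB.pack (@opT _ _ N _ S i) (GRing.isZmodMorphism.Build _ _ _ (TB i)).
pose G i : {additive Ysp N Z i.+1 -> Ysp N Z i} :=
  HB.pack (@opG _ _ N _ d S i) (GRing.isZmodMorphism.Build _ _ _ (GB i)).
pose Pi i : {additive Ysp N Z i -> Ysp N Z i} :=
  HB.pack (@PiUpsilon _ _ N _ S i) (GRing.isZmodMorphism.Build _ _ _ (PiB i)).
pose D i : {additive Ysp N Z i -> Ysp N Z i.+1} := @dV _ _ N _ d S i.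
pose S' i : {additive Ysp N Z i -> Ysp N Z i.+1} := @YS _ _ N _ S i.
pose PV' i : {additive Ysp N Z i.+1 -> Ysp N Z i} := @PV _ _ N _ S P i.
have DD i (u : Ysp N Z i) : D _ (D _ u) = 0 by exact: dVdV.
have TT i (u : Ysp N Z i.+2) : T _ (T _ u) = 0 by exact: opT_opT.
have TST i (u : Ysp N Z i.+1) : T _ (S' _ (T _ u)) = T _ u.
  by apply: opT_YS => //; have [] := opT_spec hK Z_gtN S_bounded S_closed u.
have TPi i (u : Ysp N Z i.+1) : T _ (Pi _ u) = 0 by exact: opT_Pi.
have PiT i (u : Ysp N Z i.+1) : Pi _ (T _ u) = 0 by exact: Pi_opT.
have PiU i (u : Ysp N Z i) : Upsilon S u -> Pi _ u = u by exact: PiUpsilon_id.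
have PiK i (u : Ysp N Z i) : Pi _ (Pi _ u) = Pi _ u.
  by apply: PiU; have [] := PiUpsilon_spec SS hK Z_gtN S_bounded S_closed u.
have TS0 (u : Ysp N Z 0%N) : u = T _ (S' _ u) + Pi _ u.
  exact: hodge_decomposition0.
have TSST i (u : Ysp N Z i.+1) : u = T _ (S' _ u) + S' _ (T _ u) + Pi _ u.
  exact: hodge_decomposition.
(* Adding S to d_V gives back d, which turns the recursions for G into the form used in the
   algebraic part. *)
have DSE i (u : Ysp N Z i) : D _ u + S' _ u = Yd d u by exact: subrK.
have GTl i (u : Ysp N Z i.+1) : G _ u = T _ (D _ (G _ u) + S' _ (G _ u)) - T _ u.
  by rewrite DSE; exact: opT_Yd_opG.
have GTr i (u : Ysp N Z i.+1) : G _ u = G _ (D _ (T _ u) + S' _ (T _ u)) - T _ u.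
  by rewrite DSE; exact: opG_opT_Yd.
have DPV i (u : Ysp N Z i.+1) : D _ (PV' _ u) + PV' _ (D _ u) = u by exact: dV_PV.
have DPVD (u : Ysp N Z 0%N) : D _ (PV' _ (D _ u)) = D _ u by exact: dV_PV_dV.
split=> [i|] u /PiU Uu.
  exact: (bgg_homotopy DD TT TST TPi PiT PiK TS0 TSST GTl GTr DPV Uu).
exact: (bgg_homotopy0 DD TT TST TPi PiT PiK TS0 TSST GTl GTr DPVD Uu).
Qed.
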